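(* Let $N\ge 1$ be an integer, let $q>0$ be real with $q\neq1$, and let $\alpha,\beta$ be real numbers such that none of $\alpha$, $\beta$, $\beta-\alpha+2$ belongs to $\{-N,-N+1,\dots,N\}$. With the functions $U_n(x;\alpha,\beta,N;q)$ and the scalar product $(f,g)=\sum_{x=0}^{N}w_x^{(\alpha,\beta)}f(x)g(x)$ defined in the context, the biorthogonal partners of the functions $U_n(x;\alpha,\beta,N;q)$, $n=0,\dots,N$, are, up to a normalization constant, the functions $$x\mapsto U_m(N-x;\,\beta-\alpha+2,\,\beta,\,N;\,q^{-1}),\qquad m=0,1,\dots,N.$$ That is, for each $m\in\{0,\dots,N\}$, a function $g:\{0,1,\dots,N\}\to\mathbb{R}$ satisfies $$\sum_{x=0}^{N}w_x^{(\alpha,\beta)}\,U_n(x;\alpha,\beta,N;q)\,g(x)=0\qquad\text{for all } n\in\{0,\dots,N\},\ n\neq m,$$ if and only if there is a constant $c$ with $g(x)=c\,U_m(N-x;\beta-\alpha+2,\beta,N;q^{-1})$ for all $x\in\{0,1,\dots,N\}$.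
   Context: Notation: $(a;q)_k=(1-a)(1-qa)\cdots(1-q^{k-1}a)$, with $(a;q)_0=1$. For $n=0,1,\dots,N$ and any base $q>0$, $q\ne1$, and parameters $\alpha,\beta$ for which no denominator vanishes, define $$U_n(x;\alpha,\beta,N;q)=\frac{(q^{-N};q)_n}{(q^{-n-\beta};q)_n}\sum_{k=0}^{n}\frac{(q^{-n};q)_k\,(q^{n+\beta-N};q)_k\,(q^{-x};q)_k}{(q;q)_k\,(q^{-N};q)_k\,(q^{\alpha-x};q)_k}\,q^{k(\alpha-\beta)} .$$ Thus $U_m(N-x;\beta-\alpha+2,\beta,N;q^{-1})$ means this expression with $n$ replaced by $m$, $x$ by $N-x$, $\alpha$ by $\beta-\alpha+2$, and $q$ by $q^{-1}$ throughout. The weight is the $q$-hypergeometric distribution $$w_x^{(\alpha,\beta)}=q^{(1-\alpha)N}\,\frac{(q^{\alpha-\beta-1};q)_N}{(q^{-\beta};q)_N}\;q^{(\beta+1)x}\,\frac{(q^{-N};q)_x\,(q^{1-\alpha};q)_x}{(q;q)_x\,(q^{\beta-\alpha-N+2};q)_x},\qquad x=0,1,\dots,N.$$ Biorthogonal partners of the functions $U_n$ are nonzero functions $\mathcal{U}_m$ on $\{0,1,\dots,N\}$, $m=0,\dots,N$, such that $(U_n,\mathcal{U}_m)=\delta_{n,m}H_n$ for some constants $H_n$. *)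

(* Defs.v *)
From mathcomp Require Export all_boot all_order all_algebra.
From mathcomp Require Export reals exp.

Set Implicit Arguments.
Unset Strict Implicit.
Unset Printing Implicit Defensive.

Import Order.TTheory GRing.Theory Num.Theory.

Local Open Scope ring_scope.

Definition qpoch (R : realType) (a q : R) (k : nat) : R :=
  \prod_(i < k) (1 - q ^+ i * a).

(* The argument x is an arbitrary real, not only a point of the grid.  Division by
   zero is total in MathComp, so this agrees with the usual expression only
   where no denominator vanishes. *)
Definition qU (R : realType) (n : nat) (x alpha beta : R) (N : nat) (q : R) : R :=
  qpoch (q `^ (- N%:R)) q n / qpoch (q `^ (- n%:R - beta)) q n *
  \sum_(k < n.+1)
    (qpoch (q `^ (- n%:R)) q k * qpoch (q `^ (n%:R + beta - N%:R)) q k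
       * qpoch (q `^ (- x)) q k)
    / (qpoch q q k * qpoch (q `^ (- N%:R)) q k
       * qpoch (q `^ (alpha - x)) q k)
    * q `^ (k%:R * (alpha - beta)).

Definition qweight (R : realType) (alpha beta : R) (N : nat) (q : R)
    (x : nat) : R :=
  q `^ ((1 - alpha) * N%:R)
  * (qpoch (q `^ (alpha - beta - 1)) q N / qpoch (q `^ (- beta)) q N)
  * q `^ ((beta + 1) * x%:R)
  * ((qpoch (q `^ (- N%:R)) q x * qpoch (q `^ (1 - alpha)) q x)
     / (qpoch q q x * qpoch (q `^ (beta - alpha - N%:R + 2)) q x)).

Definition qdot (R : realType) (alpha beta : R) (N : nat) (q : R)
    (f g : 'I_N.+1 -> R) : R :=
  \sum_(x < N.+1) qweight alpha beta N q x * f x * g x.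

Definition biorthogonal_partners (R : realType) (N : nat)
    (dot : ('I_N.+1 -> R) -> ('I_N.+1 -> R) -> R)
    (U V : 'I_N.+1 -> 'I_N.+1 -> R) : Prop :=
  (forall m, exists x, V m x != 0) /\
  (exists H : 'I_N.+1 -> R,
     forall n m, dot (U n) (V m) = (n == m)%:R * H n).

Definition avoids (R : realType) (N : nat) (r : R) : Prop :=
  forall k : int, - N%:Z <= k <= N%:Z -> r != k%:~R.

(* Main.v *)
(* On the functions phi_k(x) = (q^-x;q)_k / (q^(alpha-x);q)_k and on their images
   psi_j under x -> N - x, q -> 1/q, alpha -> beta - alpha + 2, the q-Vandermonde
   sum gives, with G(s) = (q^-N;q)_s / (q^(beta+1-N);q)_s and constants C, A, B,
     (phi_k, psi_j) = C A^k B^j G(k+j).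
   In (U_n, psi_j) and in (phi_j, V_n) with j < n the k-dependence of the summand is
   then (q^-n;q)_k / (q;q)_k q^k P(q^k) with deg P < n, and such a sum vanishes by
   the q-binomial theorem.  This gives biorthogonality.  Both families are products of
   triangular matrices with nonzero diagonals, hence bases, so the H_n are nonzero
   and the partners are unique up to a constant. *)
From mathcomp Require Import perm ring lra zify.
Require Import Defs.

Set Implicit Arguments.
Unset Strict Implicit.
Unset Printing Implicit Defensive.

Import Order.TTheory GRing.Theory Num.Theory.
Local Open Scope ring_scope.

(** * q-Pochhammer symbols: splitting, vanishing, inversion of the base *)

Lemma qpoch0 (R : realType) (a q : R) : qpoch a q 0 = 1.
Proof. by rewrite /qpoch big_ord0. Qed.

Lemma qpochS (R : realType) (a q : R) k :
  qpoch a q k.+1 = qpoch a q k * (1 - q ^+ k * a).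
Proof. by rewrite /qpoch big_ord_recr. Qed.

Lemma qpochD (R : realType) (a q : R) m n :
  qpoch a q (m + n) = qpoch a q m * qpoch (q ^+ m * a) q n.
Proof.
elim: n => [|n IHn]; first by rewrite addn0 qpoch0 mulr1.
by rewrite addnS !qpochS IHn mulrA [q ^+ n * _]mulrA -exprD [(n + m)%N]addnC.
Qed.

Lemma qpochSl (R : realType) (a q : R) k :
  qpoch a q k.+1 = (1 - a) * qpoch (q * a) q k.
Proof. by rewrite -add1n qpochD qpochS qpoch0 !mul1r. Qed.

Lemma qpoch0l (R : realType) (q : R) k : qpoch 0 q k = 1.
Proof.
by elim: k => [|k IHk]; rewrite ?qpoch0 // qpochS IHk mulr0 subr0 mulr1.
Qed.

Lemma qpoch_neq0 (R : realType) (a q : R) k :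
  (forall i, (i < k)%N -> q ^+ i * a != 1) -> qpoch a q k != 0.
Proof.
by move=> h; apply/prodf_neq0 => i _; rewrite subr_eq0 eq_sym h.
Qed.

Lemma qpoch_eq0 (R : realType) (a q : R) i k :
  (i < k)%N -> q ^+ i * a = 1 -> qpoch a q k = 0.
Proof.
move=> ik qia; apply/eqP/prodf_eq0; exists (Ordinal ik) => //=.
by rewrite qia subrr.
Qed.

(** Reversing the order of the factors, i -> k-1-i, trades base 1/q for base q. *)
Lemma qpoch_rev (R : realType) (c q : R) k : q != 0 ->
  qpoch (q * c)^-1 q^-1 k = qpoch (q ^+ k * c)^-1 q k.
Proof.
move=> q0; rewrite /qpoch (reindex_inj rev_ord_inj) /=.
apply: eq_bigr => i _; congr (1 - _).
have -> : q ^+ k = q ^+ (k - i.+1) * (q * q ^+ i).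
  by rewrite -exprS -exprD subnK.
have := expf_neq0 i q0; have := expf_neq0 (k - i.+1) q0.
rewrite !invfM exprVn; set u := c^-1 => n1 n2.
by field; rewrite n1 n2 q0.
Qed.

(** Each factor satisfies 1 - q^-i/x = -(1 - q^i x)/(q^i x); in the quotient the signs and the
    powers q^i cancel and d/c remains. A zero denominator occurs on both sides at once, and then
    both quotients are 0. *)
Lemma qpoch_ratioV (R : realType) (c d q : R) k : q != 0 -> c != 0 -> d != 0 ->
  qpoch c^-1 q^-1 k / qpoch d^-1 q^-1 k
  = (d / c) ^+ k * (qpoch c q k / qpoch d q k).
Proof.
move=> q0 c0 d0.
have inv (x : R) i : x != 0 -> 1 - q^-1 ^+ i * x^-1 = - (q ^+ i * x)^-1 * (1 - q ^+ i * x).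
  move=> x0; have := expf_neq0 i q0; rewrite exprVn => qi0.
  by field; rewrite x0 qi0.
elim: k => [|k IHk]; first by rewrite !qpoch0 expr0 invr1 !mulr1.
rewrite !qpochS exprS !invfM mulrACA IHk !inv // [(- _ * _)^-1]invfM invrN invrK invfM.
have := expf_neq0 k q0; move: (1 - _ * d)^-1 (1 - _ * c) => u v qk0.
move: (qpoch _ _ _)^-1 => w.
by field; rewrite c0 qk0.
Qed.

(** * Gaussian binomials and the q-Vandermonde sum *)

(* [(-1)^y q^(y(y-1)/2)] times the Gaussian binomial coefficient *)
Definition qcoef (R : realType) (q : R) (M y : nat) : R :=
  \prod_(i < y) ((q ^+ M - q ^+ i) / (1 - q ^+ i.+1)).

Lemma qcoefE (R : realType) (q : R) (M y : nat) : q != 0 ->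
  qcoef q M y = qpoch (q ^- M) q y / qpoch q q y * q ^+ (M * y).
Proof.
move=> q0; rewrite exprM /qcoef; elim: y => [|y IHy].
  by rewrite big_ord0 !qpoch0 expr0 divr1 mulr1.
have qM0 := expf_neq0 M q0.
rewrite big_ord_recr /= IHy !qpochS -[q ^+ y * q]exprSr [(q ^+ M) ^+ y.+1]exprS invfM.
set u := (1 - _)^-1; set v := (qpoch q q y)^-1.
by field.
Qed.

Lemma qcoef_eq0 (R : realType) (q : R) (M y : nat) : (M < y)%N -> qcoef q M y = 0.
Proof.
move=> My; apply/eqP/prodf_eq0; exists (Ordinal My) => //=.
by rewrite subrr mul0r.
Qed.

Lemma qcoef_pascal (R : realType) (q : R) (M y : nat) :
  (forall i, q ^+ i.+1 != 1) ->
  qcoef q M.+1 y.+1 = q ^+ y.+1 * qcoef q M y.+1 - q ^+ y * qcoef q M y.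
Proof.
move=> q1.
have nz i : 1 - q ^+ i.+1 != 0 by rewrite subr_eq0 eq_sym q1.
(* The absorption identity, a q-analogue of (y+1) C(M+1,y+1) = (M+1) C(M,y), reduces every term to a
   multiple of [qcoef q M y]. *)
have -> : qcoef q M.+1 y.+1
    = (q ^+ M.+1 - 1) * q ^+ y * qcoef q M y / (1 - q ^+ y.+1).
  elim: y => [|y IHy].
    by rewrite /qcoef big_ord_recr !big_ord0 /= expr0; field; exact: (nz 0).
  rewrite {1}/qcoef big_ord_recr /= -/(qcoef q M.+1 y.+1) IHy.
  rewrite /qcoef [in RHS]big_ord_recr /= -/(qcoef q M y).
  have := nz y.+1; have := nz y; rewrite !exprS => n1 n2.
  by field; rewrite n1 n2.
rewrite {2}/qcoef big_ord_recr /= -/(qcoef q M y).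
by have := nz y; rewrite !exprS => n1; field.
Qed.

(** The q-Vandermonde sum with lower parameter tA, multiplied by (tA;q)_M so that no denominator
    involves t or A; A = 0 gives the q-binomial theorem. Induction on M with t varying: after the
    Pascal rule, the two terms with the same y differ by the factor (1 - q^y tA) - t(1 - q^y A) = 1
    - t, and what is left is the sum for M at qt. *)
Lemma q_vandermonde (R : realType) (q t A : R) (M : nat) :
  (forall i, q ^+ i.+1 != 1) ->
  \sum_(y < M.+1) qcoef q M y * t ^+ y * qpoch A q y
     * qpoch (q ^+ y * (t * A)) q (M - y)
  = qpoch t q M.
Proof.
move=> q1; elim: M t => [|M IHM] t.
  by rewrite big_ord1 /qcoef big_ord0 !qpoch0 expr0 !mul1r.
rewrite big_ord_recl (eq_bigr (fun y : 'I_M.+1 =>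
    q ^+ y.+1 * qcoef q M y.+1 * t ^+ y.+1 * qpoch A q y.+1
      * qpoch (q ^+ y.+1 * (t * A)) q (M - y)
  - q ^+ y * qcoef q M y * t ^+ y.+1 * qpoch A q y.+1
      * qpoch (q ^+ y.+1 * (t * A)) q (M - y))); last first.
  by move=> y _; rewrite qcoef_pascal //= /bump /= add1n subSS; ring.
rewrite big_split /= addrA.
have -> : qcoef q M.+1 0 = q ^+ 0 * qcoef q M 0 by rewrite /qcoef !big_ord0 mulr1.
rewrite -(big_ord_recl M.+1 (fun y : 'I_M.+2 =>
  q ^+ y * qcoef q M y * t ^+ y * qpoch A q y
      * qpoch (q ^+ y * (t * A)) q (M.+1 - y))).
(* The first of the two sums loses its top term y = M+1, so both now run over y <= M. *)
rewrite big_ord_recr /= qcoef_eq0 // mulr0 !mul0r addr0 -big_split /=.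
rewrite qpochSl -IHM mulr_sumr; apply: eq_bigr => y _.
have yM : (y <= M)%N by rewrite -ltnS.
rewrite subSn // qpochSl qpochS exprMn [t ^+ _.+1]exprS.
have -> : q * (q ^+ y * (t * A)) = q ^+ y.+1 * (t * A) by rewrite exprS mulrA.
have -> : q ^+ y * (q * t * A) = q ^+ y.+1 * (t * A) by rewrite exprS; ring.
by ring.
Qed.

(** * Sums annihilated by the q-binomial theorem *)

(** By linearity take P = z^i with i < n: the q-binomial theorem gives (q^(i+1-n);q)_n, whose factor
    of index n-1-i is 0. *)
Lemma qcoef_sum_poly (R : realType) (q : R) (n : nat) (P : {poly R}) :
  q != 0 -> (forall i, q ^+ i.+1 != 1) -> (size P <= n)%N ->
  \sum_(k < n.+1) qcoef q n k * (q ^- n * q) ^+ k * P.[q ^+ k] = 0.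
Proof.
move=> q0 q1 sP.
under eq_bigr => k _ do rewrite (horner_coef_wide _ sP) mulr_sumr.
rewrite exchange_big /=; apply: big1 => i _.
transitivity (P`_i * qpoch (q ^- n * q ^+ i.+1) q n).
  rewrite -(@q_vandermonde _ q _ 0) // mulr_sumr; apply: eq_bigr => k _.
  rewrite !mulr0 !qpoch0l !mulr1 !exprMn [q ^+ i.+1]exprS exprMn.
  by rewrite -!exprM [(i * k)%N]mulnC; ring.
rewrite (@qpoch_eq0 _ _ _ (n - i.+1)%N) ?mulr0 //; first by have := ltn_ord i; lia.
by rewrite mulrCA -exprD subnK // mulVf ?expf_neq0.
Qed.

Lemma qpoch_poly (R : realType) (q c : R) k :
  exists2 P : {poly R}, (size P <= k.+1)%N & forall z, P.[z] = qpoch (z * c) q k.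
Proof.
elim: k => [|k [P sP hP]].
  by exists 1; [rewrite size_poly1 | move=> z; rewrite hornerC qpoch0].
exists (P * (1 - (q ^+ k * c) *: 'X)).
  apply: leq_trans (size_polyMleq _ _) _.
  have s2 : (size (1 - (q ^+ k * c) *: 'X : {poly R})%R <= 2)%N.
    apply: leq_trans (size_polyD _ _) _; rewrite geq_max size_poly1 size_polyN /=.
    by apply: leq_trans (size_scale_leq _ _) _; rewrite size_polyX.
  by lia.
by move=> z; rewrite !hornerE hP qpochS; congr (_ * (1 - _)); ring.
Qed.

(* The coefficients of U_n on the functions (q^-x;q)_k / (q^(alpha-x);q)_k, up to
   factors independent of k and k-th powers; replacing q and b by their inverses only
   changes them by such factors, so they serve for both families. *)
Definition ucoef (R : realType) (q b : R) (N n k : nat) : R :=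
  qpoch (q ^- n) q k * qpoch (q ^+ n * b / q ^+ N) q k
    / (qpoch q q k * qpoch (q ^- N) q k).

(** Two quotients telescope to polynomials in z = q^k: (q^-N;q)_(k+j) / (q^-N;q)_k = (z q^-N;q)_j
    and, since q^n b/q^N = q^(n-1) g, also (q^(n-1) g;q)_k / (g;q)_(k+j) = (z q^j g;q)_(n-1-j) /
    (g;q)_(n-1). Their product has degree at most n-1. The bound on i in the hypothesis comes from
    k+j <= 2n-1 <= 2N-1. *)
Lemma ucoef_sum_eq0 (R : realType) (q b : R) (N n j : nat) :
  q != 0 -> (forall i, q ^+ i.+1 != 1) ->
  (forall i, (i < N.*2.-1)%N -> q ^+ i * (b * q / q ^+ N) != 1) ->
  (n <= N)%N -> (j < n)%N ->
  \sum_(k < n.+1)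
     ucoef q b N n k * q ^+ k
     * (qpoch (q ^- N) q (k + j) / qpoch (b * q / q ^+ N) q (k + j)) = 0.
Proof.
move=> q0 q1; set g := b * q / q ^+ N => hg nN jn.
have [P sP hP] := qpoch_poly q (q ^- N) j.
have [Q sQ hQ] := qpoch_poly q (q ^+ j * g) (n.-1 - j).
have sPQ : (size (P * Q)%R <= n)%N by apply: leq_trans (size_polyMleq _ _) _; lia.
have nz k : (k <= N.*2.-1)%N -> qpoch g q k != 0.
  by move=> kN; apply: qpoch_neq0 => i ik; apply: hg; lia.
transitivity ((qpoch g q n.-1)^-1 *
    (\sum_(k < n.+1) qcoef q n k * (q ^- n * q) ^+ k * (P * Q).[q ^+ k])); last first.
  by rewrite qcoef_sum_poly // mulr0.
rewrite mulr_sumr; apply: eq_bigr => k _; have kn := ltn_ord k; rewrite ltnS in kn.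
rewrite /ucoef hornerM hP hQ qcoefE // exprMn exprVn -exprM.
have n1 : qpoch (q ^- N) q k != 0.
  apply: qpoch_neq0 => i ik.
  have -> : q ^+ N = q ^+ (N - i.+1).+1 * q ^+ i by rewrite -exprD; congr (_ ^+ _); lia.
  by rewrite invfM mulrCA divff ?expf_neq0 // mulr1 invr_eq1.
have n2 := nz (k + j)%N ltac:(lia).
have n3 := nz n.-1 ltac:(lia).
have n4 : q ^+ (n * k) != 0 by rewrite expf_neq0.
(* Both sides are (g;q)_(n-1+k), cut at n-1 on the left and at k+j on the right. *)
have e1 : qpoch g q (n.-1) * qpoch (q ^+ n * b / q ^+ N) q k
   = qpoch g q (k + j) * qpoch (q ^+ k * (q ^+ j * g)) q (n.-1 - j).
  have -> : q ^+ n * b / q ^+ N = q ^+ n.-1 * g.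
    by rewrite /g -[in LHS](@prednK n) ?exprSr; [ring | lia].
  rewrite [q ^+ k * _]mulrA -exprD -!qpochD; congr (qpoch _ _ _); lia.
rewrite ![qpoch _ _ (k + j)]qpochD; rewrite qpochD in n2; rewrite qpochD in e1.
have -> : qpoch (q ^+ n * b / q ^+ N) q k = (qpoch g q n.-1)^-1 *
   (qpoch g q k * qpoch (q ^+ k * g) q j * qpoch (q ^+ k * (q ^+ j * g)) q (n.-1 - j)).
  by rewrite -e1 mulKf.
move: n2; rewrite mulf_eq0 negb_or => /andP[n5 n6].
rewrite [in LHS]invfM; move: (qpoch q q k)^-1 => u.
by field; rewrite n1 n3 n4 n5 n6.
Qed.

(** * Scalar products of the basis functions *)

(** In this form phi_k at x = y+k cancels against the weight: (q/a;q)_x / (q;q)_x becomes (q/a;q)_y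
    / (q;q)_y. *)
Lemma ubasis_grid (R : realType) (q a : R) (y k : nat) : q != 0 -> a != 0 ->
  qpoch (q ^- (y + k)) q k / qpoch (a / q ^+ (y + k)) q k
  = a ^- k * (qpoch (q ^+ y.+1) q k / qpoch (q ^+ y.+1 / a) q k).
Proof.
move=> q0 a0; have n1 := expf_neq0 y q0; have n2 := expf_neq0 k q0.
have -> : a / q ^+ (y + k) = (q ^+ k * (q ^+ y / a))^-1.
  by rewrite exprD; field; rewrite a0 n1 n2.
have -> : q ^- (y + k) = (q ^+ k * q ^+ y)^-1 by rewrite addnC exprD.
rewrite -!qpoch_rev // mulrA -exprS qpoch_ratioV ?mulf_neq0 ?invr_eq0 ?expf_neq0 //.
congr (_ * _); rewrite -[RHS]exprVn; congr (_ ^+ _).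
by rewrite mulrAC divff ?expf_neq0 // mul1r.
Qed.

(** The symbols of psi_j extend those of the weight to length x+j, and the summand vanishes unless k
    <= x <= N-j. Putting x = y+k leaves a q-Vandermonde sum over y <= M = N-k-j with A = q/a and t =
    bq/q^M, for which tA = q^(k+j) d. *)
Lemma basis_dot (R : realType) (q a b : R) (N k j : nat) :
  q != 0 -> a != 0 -> (forall i, q ^+ i.+1 != 1) ->
  let d := b * q ^+ 2 / a / q ^+ N in
  let g := b * q / q ^+ N in
  (forall i, (i < N)%N -> q ^+ i * (q / a) != 1) ->
  (forall i, (i < N)%N -> q ^+ i * d != 1) ->
  (forall i, (i < N)%N -> q ^+ i * g != 1) ->
  \sum_(x < N.+1) (b * q) ^+ x
     * (qpoch (q ^- N) q x * qpoch (q / a) q x / (qpoch q q x * qpoch d q x))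
     * (qpoch (q ^- x) q k / qpoch (a / q ^+ x) q k)
     * (qpoch (q ^+ x * q ^- N) q j / qpoch (q ^+ x * d) q j)
  = qpoch g q N / qpoch d q N * (b * q / a) ^+ k
    * (qpoch (q ^- N) q (k + j) / qpoch g q (k + j)).
Proof.
move=> q0 a0 q1 d g ha hd hg.
pose F x := (b * q) ^+ x
     * (qpoch (q / a) q x / qpoch q q x)
     * (qpoch (q ^- x) q k / qpoch (a / q ^+ x) q k)
     * (qpoch (q ^- N) q (x + j) / qpoch d q (x + j)).
have FE (x : 'I_N.+1) : F x = (b * q) ^+ x
     * (qpoch (q ^- N) q x * qpoch (q / a) q x / (qpoch q q x * qpoch d q x))
     * (qpoch (q ^- x) q k / qpoch (a / q ^+ x) q k)
     * (qpoch (q ^+ x * q ^- N) q j / qpoch (q ^+ x * d) q j).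
  rewrite /F !qpochD !invfM.
  move: (qpoch _ _ _)^-1 (qpoch _ _ _)^-1 (qpoch _ _ _)^-1 (qpoch _ _ _)^-1.
  by move=> *; ring.
under eq_bigr => x _ do rewrite -FE.
have qN0 m : (N < m)%N -> qpoch (q ^- N) q m = 0.
  by move=> Nm; apply: (qpoch_eq0 Nm); rewrite divff ?expf_neq0.
have F1 x : (x < k)%N -> F x = 0.
  move=> xk; rewrite /F (@qpoch_eq0 _ (q ^- x) _ x) ?divff ?expf_neq0 //.
  by rewrite !(mul0r, mulr0).
have F2 x : (N < x + j)%N -> F x = 0.
  by move=> xj; rewrite /F qN0 // !(mul0r, mulr0).
(* If k+j > N, no x satisfies k <= x <= N-j, and the right side contains (q^-N;q)_(k+j) = 0. *)
have [kjN|Nkj] := leqP (k + j) N; last first.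
  rewrite qN0 // mul0r mulr0 big1 // => x _.
  have [/F1//|kx] := ltnP x k.
  by apply: F2; lia.
rewrite -(big_mkord xpredT F) (@big_cat_nat _ _ _ k) //=; last by lia.
rewrite big_nat big1 ?add0r; last by move=> x /andP[_ /F1].
rewrite -[k in \sum_(k <= _ < _) _]add0n big_addn.
pose M := (N - (k + j))%N.
rewrite (@big_cat_nat _ _ _ M.+1) //=; last by rewrite /M; lia.
rewrite [X in _ + X]big_nat [X in _ + X]big1 ?addr0; last first.
  by move=> y /andP[My _]; apply: F2; rewrite /M in My; lia.
rewrite big_mkord.
set s := (k + j)%N in M kjN *; have sE : s = (k + j)%N by [].
clearbody s.
have NE : N = (s + M)%N by rewrite /M; lia.
have nzq m : q ^+ m != 0 by rewrite expf_neq0.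
have qsM : q ^+ s * q ^- N = q ^- M by rewrite NE exprD; field; rewrite !nzq.
pose C := q ^+ s * d.
pose t := b * q / q ^+ M.
have tA : t * (q / a) = C.
  by rewrite /t /C /d NE exprD; field; rewrite !nzq a0.
have nzd m : (m <= N)%N -> qpoch d q m != 0.
  by move=> mN; apply: qpoch_neq0 => i im; apply: hd; lia.
have nzg m : (m <= N)%N -> qpoch g q m != 0.
  by move=> mN; apply: qpoch_neq0 => i im; apply: hg; lia.
have nzA m : (m <= N)%N -> qpoch (q / a) q m != 0.
  by move=> mN; apply: qpoch_neq0 => i im; apply: ha; lia.
have nzqq m : qpoch q q m != 0.
  by apply: qpoch_neq0 => i _; rewrite -exprSr.
have dN : qpoch d q N = qpoch d q s * qpoch C q M by rewrite NE qpochD.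
have gN : qpoch g q N = qpoch g q s * qpoch t q M.
  rewrite NE qpochD; congr (_ * qpoch _ _ _).
  by rewrite /g /t NE exprD; field; rewrite !nzq.
have := nzd N (leqnn _); rewrite dN mulf_eq0 negb_or => /andP[nds nCM].
(* The denominators (d;q)_(s+y) are brought to the common one (d;q)_N by means of (C;q)_M = (C;q)_y
   (q^y C;q)_(M-y). *)
transitivity (\sum_(y < M.+1) (b * q / a) ^+ k * (qpoch (q ^- N) q s / qpoch d q N)
   * (qcoef q M y * t ^+ y * qpoch (q / a) q y
      * qpoch (q ^+ y * (t * (q / a))) q (M - y))).
  apply: eq_bigr => y _; have yM := ltn_ord y; rewrite ltnS in yM.
  rewrite /F ubasis_grid // tA qcoefE //.
  have -> : (y + k + j = s + y)%N by lia.
  rewrite !qpochD qsM -/C dN.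
  have CM : qpoch C q M = qpoch C q y * qpoch (q ^+ y * C) q (M - y).
    by rewrite -qpochD subnKC.
  move: nCM; rewrite CM mulf_eq0 negb_or => /andP[nC1 nC2].
  have := nzqq (y + k)%N; rewrite qpochD -exprSr mulf_eq0 negb_or => /andP[n1 n2].
  have ykN : (y + k <= N)%N by lia.
  have := nzA (y + k)%N ykN; rewrite qpochD mulrA -exprSr mulf_eq0 negb_or => /andP[n3 n4].
  have -> : t ^+ y = (b * q) ^+ y / q ^+ (M * y) by rewrite /t exprMn exprVn -exprM.
  have -> : (b * q / a) ^+ k = (b * q) ^+ k / a ^+ k by rewrite [LHS]exprMn exprVn.
  have ak0 : a ^+ k != 0 by rewrite expf_neq0.
  rewrite [(b * q) ^+ (y + k)]exprD.
  move: ((b * q) ^+ y) ((b * q) ^+ k) => z1 z2.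
  by field; rewrite ak0 nzq nds nC1 nC2 n1 n2 n4.
rewrite -mulr_sumr q_vandermonde // gN dN.
have ngs := nzg s kjN.
by field; rewrite ngs nds nCM.
Qed.

(** * Linear algebra of biorthogonal bases *)

(** With A = U diag(w), the Gram matrix A V^T is diagonal and invertible, so every H_m is nonzero.
    Since A is injective, g is determined by its products with the U_n. *)
Lemma biorthogonal_of_unitmx (R : realType) (N : nat)
    (dot : ('I_N.+1 -> R) -> ('I_N.+1 -> R) -> R) (w : 'I_N.+1 -> R)
    (U V : 'I_N.+1 -> 'I_N.+1 -> R) :
  (forall f g, dot f g = \sum_x w x * f x * g x) ->
  (forall x, w x != 0) ->
  (\matrix_(n, x) U n x) \in unitmx -> (\matrix_(m, x) V m x) \in unitmx ->
  (forall n m, n != m -> dot (U n) (V m) = 0) ->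
  biorthogonal_partners dot U V /\
  (forall m g, (forall n, n != m -> dot (U n) g = 0) <->
     (exists c : R, forall x, g x = c * V m x)).
Proof.
move=> dotE w0 unitU unitV UV.
pose A := (\matrix_(n, x) U n x) *m diag_mx (\row_x w x).
have unitA : A \in unitmx.
  rewrite unitmx_mul unitU unitmxE det_diag unitfE.
  by apply/prodf_neq0 => x _; rewrite mxE.
have AE f n : (A *m \col_x f x) n 0 = dot (U n) f.
  rewrite dotE mxE; apply: eq_bigr => x _.
  by rewrite /A mul_mx_diag !mxE [w x * _]mulrC.
pose H m := dot (U m) (V m).
have H0 m : H m != 0.
  have : A *m (\matrix_(m, x) V m x)^T \in unitmx.
    by rewrite unitmx_mul unitA unitmx_tr.
  have -> : A *m (\matrix_(m, x) V m x)^T = diag_mx (\row_m H m).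
    apply/matrixP => n p; rewrite [RHS]mxE mxE.
    transitivity (dot (U n) (V p)).
      by rewrite -AE mxE; apply: eq_bigr => x _; rewrite !mxE.
    by have [->|np] := eqVneq n p; rewrite ?mxE ?mulr1n // UV.
  rewrite unitmxE det_diag unitfE => /prodf_neq0/(_ m isT).
  by rewrite mxE.
split; first split.
- move=> m; apply/existsP; rewrite -negb_forall; apply/negP => /forallP Vm0.
  have := H0 m; rewrite /H dotE big1 ?eqxx // => x _.
  by rewrite (eqP (Vm0 x)) mulr0.
- exists H => n m; have [->|nm] := eqVneq n m; first by rewrite mul1r.
  by rewrite UV // mul0r.
move=> m g; split=> [gU|[c gc] n nm]; last first.
  transitivity (c * dot (U n) (V m)); last by rewrite UV // mulr0.
  rewrite !dotE mulr_sumr.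
  by apply: eq_bigr => x _; rewrite gc; ring.
(* This c is forced by pairing g = c V_m with U_m; the products with the other U_n vanish on both
   sides. *)
exists (dot (U m) g / H m) => x.
set c := dot _ _ / _.
suff /matrixP/(_ x 0) : \col_x g x = \col_x (c * V m x) by rewrite !mxE.
apply: (can_inj (mulKmx unitA)); apply/colP => n; rewrite !AE.
have -> : dot (U n) (fun x => c * V m x) = c * dot (U n) (V m).
  by rewrite !dotE mulr_sumr; apply: eq_bigr => y _; ring.
have [->|nm] := eqVneq n m; first by rewrite divfK.
by rewrite gU // UV // mulr0.
Qed.

(** * Comparing real powers of q *)

Lemma neq1_mulr (R : realType) (x z w : R) : x * z = w -> w != z -> x != 1.
Proof. by move=> <-; apply: contra_neq => ->; rewrite mul1r. Qed.

Lemma expr_neq1 (R : realType) (q : R) i : 0 < q -> q != 1 -> q ^+ i.+1 != 1.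
Proof. by move=> q_gt0 q_neq1; rewrite pexpr_eq1 ?ltW. Qed.

(** Equality would force r = n - m, as t -> q^t is injective; the two inequalities on naturals say
    |n - m| <= N. *)
Lemma avoids_expr (R : realType) (N : nat) (q r : R) (m n : nat) :
  0 < q -> q != 1 -> avoids N r -> (m <= n + N)%N -> (n <= m + N)%N ->
  q ^+ m * q `^ r != q ^+ n.
Proof.
move=> q_gt0 q_neq1 rP mn nm; have q0 : q != 0 by rewrite gt_eqF.
rewrite -!powR_mulrn ?ltW // -powRD ?q0 ?implybT //.
have -> : m%:R + r = (m%:R + r - n%:R) + n%:R by rewrite subrK.
rewrite powRD ?q0 ?implybT // -[X in _ != X]mul1r.
rewrite (inj_eq (mulIf _)) ?powR_eq0 ?(negPf q0) //.
rewrite powR_eq1 (negPf q_neq1) ltNge ltW //=.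
have := rP (n%:Z - m%:Z) ltac:(lia); apply: contra_neq => e.
rewrite rmorphB /=. lra.
Qed.

(** * Both families expanded in basis functions, and their invertibility *)

Definition ubasis (R : realType) (q a : R) (k x : nat) : R :=
  qpoch (q ^- x) q k / qpoch (a / q ^+ x) q k.

Lemma qU_grid (R : realType) (N n x : nat) (q alpha beta : R) : 0 < q ->
  qU n x%:R alpha beta N q
  = qpoch (q ^- N) q n / qpoch (q ^- n / q `^ beta) q n
    * \sum_(k < n.+1) ucoef q (q `^ beta) N n k
        * (q `^ alpha / q `^ beta) ^+ k * ubasis q (q `^ alpha) k x.
Proof.
move=> q_gt0; have q0 : q != 0 by rewrite gt_eqF.
have pD r s : q `^ (r + s) = q `^ r * q `^ s by rewrite powRD // q0 implybT.
rewrite /qU /ucoef /ubasis !pD !powRN !powR_mulrn ?ltW //.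
congr (_ * _); apply: eq_bigr => k _.
have -> : q `^ (k%:R * (alpha - beta)) = (q `^ alpha / q `^ beta) ^+ k.
  by rewrite mulrC powRrM powR_mulrn ?powR_ge0 // pD powRN.
rewrite !invfM.
move: (qpoch _ _ _)^-1 (qpoch _ _ _)^-1 (qpoch _ _ _)^-1.
by move=> *; ring.
Qed.

(** Every quotient of symbols in base 1/q returns to base q through [qpoch_ratioV] at the price of a
    k-th power. [K] is the prefactor of U_n in base 1/q, free of x. *)
Lemma qU_dual_grid (R : realType) (N n : nat) (q alpha beta : R) : 0 < q ->
  let d := q `^ beta * q ^+ 2 / q `^ alpha / q ^+ N in
  exists K, forall x : nat, (x <= N)%N ->
  qU n (N%:R - x%:R) (beta - alpha + 2) beta N q^-1
  = K * \sum_(k < n.+1) ucoef q (q `^ beta) N n k * q ^+ k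
        * (qpoch (q ^+ x * q ^- N) q k / qpoch (q ^+ x * d) q k).
Proof.
move=> q_gt0 d; have q0 : q != 0 by rewrite gt_eqF.
eexists=> x xN; rewrite -natrB // qU_grid ?invr_gt0 //; congr (_ * _).
have qV r : q^-1 `^ r = (q `^ r)^-1.
  by rewrite -powR_inv1 ?ltW // -powRrM mulN1r powRN.
have -> : q^-1 `^ (beta - alpha + 2) = (q `^ beta * q ^+ 2 / q `^ alpha)^-1.
  by rewrite qV 2?powRD ?q0 ?implybT // powRN powR_mulrn ?ltW // mulrAC.
rewrite qV /d; set b := q `^ beta; set a := q `^ alpha.
have b0 : b != 0 by rewrite powR_eq0 negb_and q0.
have a0 : a != 0 by rewrite powR_eq0 negb_and q0.
have nzq m : q ^+ m != 0 by rewrite expf_neq0.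
apply: eq_bigr => k _; rewrite /ucoef /ubasis.
have swap (x1 x2 x3 x4 : R) : x1 * x2 / (x3 * x4) = (x1 / x3) * (x2 / x4).
  by rewrite invfM; ring.
rewrite !swap !exprVn !invrK.
have e1 : qpoch (q ^+ n) q^-1 k / qpoch q^-1 q^-1 k
    = (q / q ^- n) ^+ k * (qpoch (q ^- n) q k / qpoch q q k).
  by rewrite -qpoch_ratioV ?invr_eq0 // invrK.
have e2 : qpoch (q ^- n / b * q ^+ N) q^-1 k / qpoch (q ^+ N) q^-1 k
    = (q ^- N / (q ^+ n * b / q ^+ N)) ^+ k
      * (qpoch (q ^+ n * b / q ^+ N) q k / qpoch (q ^- N) q k).
  rewrite -qpoch_ratioV ?mulf_neq0 ?invr_eq0 // invrK; congr (qpoch _ _ _ / _).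
  by field; rewrite !nzq b0.
have e3 : qpoch (q ^+ (N - x)) q^-1 k
      / qpoch ((b * q ^+ 2 / a)^-1 * q ^+ (N - x)) q^-1 k
    = (b * q ^+ 2 / a) ^+ k
      * (qpoch (q ^+ x / q ^+ N) q k / qpoch (q ^+ x * (b * q ^+ 2 / a / q ^+ N)) q k).
  have NE : q ^+ N = q ^+ (N - x) * q ^+ x by rewrite -exprD subnK.
  transitivity (((q ^+ x * (b * q ^+ 2 / a / q ^+ N)) / (q ^+ x / q ^+ N)) ^+ k
    * (qpoch (q ^+ x / q ^+ N) q k / qpoch (q ^+ x * (b * q ^+ 2 / a / q ^+ N)) q k)).
    rewrite -qpoch_ratioV ?mulf_neq0 ?invr_eq0 // NE.
    by congr (qpoch _ _ _ / qpoch _ _ _); field; rewrite ?nzq ?b0 ?a0 ?q0.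
  by congr (_ ^+ _ * _); field; rewrite !nzq a0.
rewrite e1 e2 e3.
(* All k-th powers together: those from [e1], [e2], the parameter factor of U_n in base 1/q, and
   that from [e3]; the product of their bases is q. *)
have -> : q ^+ k = (q / q ^- n) ^+ k * (q ^- N / (q ^+ n * b / q ^+ N)) ^+ k
    * ((b * q ^+ 2 / a)^-1 * b) ^+ k * (b * q ^+ 2 / a) ^+ k.
  by rewrite -!exprMn; congr (_ ^+ _); field; rewrite ?nzq ?b0 ?a0 ?q0.
by ring.
Qed.

(** Both factors in L P^T come from triangular arrays, because (q^-n;q)_k = 0 for k > n and
    (q^-x;q)_k = 0 for k > x. The excluded values of alpha and beta keep the diagonals nonzero,
    denominators included. *)
Lemma qU_unitmx (R : realType) (N : nat) (q alpha beta : R) :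
  0 < q -> q != 1 -> avoids N alpha -> avoids N beta ->
  (\matrix_(n < N.+1, x < N.+1) qU n x%:R alpha beta N q) \in unitmx.
Proof.
move=> q_gt0 q_neq1 alphaP betaP; have q0 : q != 0 by rewrite gt_eqF.
have nzq m : q ^+ m != 0 by rewrite expf_neq0.
have q1 i : q ^+ i.+1 != 1 by apply: expr_neq1.
have b0 : q `^ beta != 0 by rewrite powR_eq0 negb_and q0.
have a0 : q `^ alpha != 0 by rewrite powR_eq0 negb_and q0.
pose c n := qpoch (q ^- N) q n / qpoch (q ^- n / q `^ beta) q n.
pose r := q `^ alpha / q `^ beta.
have qn0 n k : (n < k)%N -> qpoch (q ^- n) q k = 0.
  by move=> nk; apply: (qpoch_eq0 nk); rewrite divff.
have qn1 n k : (k <= n)%N -> qpoch (q ^- n) q k != 0.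
  move=> kn; apply: qpoch_neq0 => i ik.
  apply: (@neq1_mulr _ _ (q ^+ (n - i)) 1); last by rewrite eq_sym -subnSK ?q1 ?(leq_trans ik).
  by rewrite mulrAC -exprD subnKC ?divff // ltnW // (leq_trans ik).
pose L := \matrix_(n < N.+1, k < N.+1) (c n * ucoef q (q `^ beta) N n k * r ^+ k).
pose P := \matrix_(x < N.+1, k < N.+1) ubasis q (q `^ alpha) k x.
have -> : (\matrix_(n < N.+1, x < N.+1) qU n x%:R alpha beta N q) = L *m P^T.
  apply/matrixP => n x; rewrite !mxE qU_grid // mulr_sumr.
  rewrite (big_ord_widen N.+1 (fun k : nat => c n *
    (ucoef q (q `^ beta) N n k * r ^+ k * ubasis q (q `^ alpha) k x)) (ltn_ord n)).
  rewrite big_mkcond; apply: eq_bigr => k _; rewrite !mxE.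
  case: ltnP => [_|nk]; first by rewrite !mulrA.
  by rewrite /ucoef qn0 // !(mul0r, mulr0).
rewrite unitmx_mul unitmx_tr !unitmxE !det_trig ?unitfE.
- apply/andP; split; apply/prodf_neq0 => n _; have nN := ltn_ord n; rewrite mxE.
    rewrite /c /ucoef !mulf_neq0 ?invr_eq0 ?expf_neq0 ?mulf_neq0 ?invr_eq0 ?qn1 //.
    + apply: qpoch_neq0 => i ni.
      apply: (@neq1_mulr _ _ (q ^+ n * q `^ beta) (q ^+ i)); first by field; rewrite nzq b0.
      by rewrite eq_sym; apply: (@avoids_expr _ N) => //; lia.
    + apply: qpoch_neq0 => i ni.
      apply: (@neq1_mulr _ _ (q ^+ N) (q ^+ (i + n) * q `^ beta)).
        by rewrite exprD; field; rewrite nzq.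
      by apply: (@avoids_expr _ N) => //; lia.
    + by apply: qpoch_neq0 => i _; rewrite -exprSr.
  rewrite /ubasis mulf_neq0 ?invr_eq0 ?qn1 //.
  apply: qpoch_neq0 => i ni.
  apply: (@neq1_mulr _ _ (q ^+ n) (q ^+ i * q `^ alpha)); first by field; rewrite nzq.
  by apply: (@avoids_expr _ N) => //; lia.
- by apply/is_trig_mxP => x k xk; rewrite mxE /ubasis qn0 // mul0r.
- by apply/is_trig_mxP => n k nk; rewrite mxE /ucoef qn0 // !(mul0r, mulr0).
Qed.

(** * The weight and the orthogonality relations *)

Lemma dot_expand (R : realType) (I J K : finType) (w : I -> R)
    (f : J -> R) (g : K -> R) (phi : J -> I -> R) (psi : K -> I -> R) :
  \sum_x w x * (\sum_k f k * phi k x) * (\sum_j g j * psi j x)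
  = \sum_k \sum_j f k * g j * \sum_x w x * phi k x * psi j x.
Proof.
under eq_bigr => x _ do rewrite -mulrA big_distrlr mulr_sumr /=.
rewrite exchange_big /=; apply: eq_bigr => k _.
under eq_bigr => x _ do rewrite mulr_sumr.
rewrite exchange_big /=; apply: eq_bigr => j _.
by rewrite mulr_sumr; apply: eq_bigr => x _; ring.
Qed.

Lemma qweightE (R : realType) (N : nat) (q alpha beta : R) (x : nat) : 0 < q ->
  let a := q `^ alpha in let b := q `^ beta in
  let d := b * q ^+ 2 / a / q ^+ N in
  qweight alpha beta N q x
  = q `^ ((1 - alpha) * N%:R)
    * (qpoch (q `^ (alpha - beta - 1)) q N / qpoch (q `^ (- beta)) q N)
    * ((b * q) ^+ x
       * (qpoch (q ^- N) q x * qpoch (q / a) q x / (qpoch q q x * qpoch d q x))).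
Proof.
move=> q_gt0 a b d; have q0 : q != 0 by rewrite gt_eqF.
have pD r s : q `^ (r + s) = q `^ r * q `^ s by rewrite powRD // q0 implybT.
rewrite /qweight -[LHS]mulrA.
have -> : q `^ ((beta + 1) * x%:R) = (b * q) ^+ x.
  by rewrite powRrM powR_mulrn ?powR_ge0 // pD powRr1 // ltW.
have -> : q `^ (beta - alpha - N%:R + 2) = d.
  by rewrite 3!pD !powRN !powR_mulrn ?ltW // /d -/a -/b; ring.
have -> : q `^ (1 - alpha) = q / a by rewrite pD powRN powRr1 // ltW.
have -> : q `^ (- N%:R) = q ^- N by rewrite powRN powR_mulrn ?ltW.
by rewrite !mulrA.
Qed.

Lemma qpow_alpha_neq1 (R : realType) (N : nat) (q alpha : R) (i : nat) :
  0 < q -> q != 1 -> avoids N alpha -> (i < N)%N ->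
  q ^+ i * (q / q `^ alpha) != 1.
Proof.
move=> q_gt0 q_neq1 alphaP iN; have a0 : q `^ alpha != 0.
  by rewrite powR_eq0 negb_and gt_eqF.
apply: (@neq1_mulr _ _ (q `^ alpha) (q ^+ i.+1)).
  by rewrite exprSr mulrA mulfVK.
by rewrite eq_sym -[q `^ _]mul1r; apply: (@avoids_expr _ N _ _ 0) => //; lia.
Qed.

Lemma qpow_shift_neq1 (R : realType) (N : nat) (q alpha beta : R) (i : nat) :
  0 < q -> q != 1 -> avoids N (beta - alpha + 2) -> (i < N)%N ->
  q ^+ i * (q `^ beta * q ^+ 2 / q `^ alpha / q ^+ N) != 1.
Proof.
move=> q_gt0 q_neq1 beta_alphaP iN; have q0 : q != 0 by rewrite gt_eqF.
have a0 : q `^ alpha != 0 by rewrite powR_eq0 negb_and q0.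
apply: (@neq1_mulr _ _ (q ^+ N) (q ^+ i * (q `^ (beta - alpha + 2)))).
  rewrite 2?powRD ?q0 ?implybT // powRN powR_mulrn ?ltW //.
  by field; rewrite expf_neq0 // a0.
by apply: (@avoids_expr _ N) => //; lia.
Qed.

Lemma qweight_neq0 (R : realType) (N : nat) (q alpha beta : R) (x : nat) :
  0 < q -> q != 1 ->
  avoids N alpha -> avoids N beta -> avoids N (beta - alpha + 2) -> (x <= N)%N ->
  qweight alpha beta N q x != 0.
Proof.
move=> q_gt0 q_neq1 alphaP betaP beta_alphaP xN.
have q0 : q != 0 by rewrite gt_eqF.
have nzq k : q ^+ k != 0 by rewrite expf_neq0.
have pD r s : q `^ (r + s) = q `^ r * q `^ s by rewrite powRD // q0 implybT.
have nzp r : q `^ r != 0 by rewrite powR_eq0 negb_and q0.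
have qd r k : avoids N r -> (0 < k <= N)%N -> q ^+ k != q `^ r.
  by move=> rP kN; rewrite eq_sym -[q `^ r]mul1r; apply: (@avoids_expr _ N _ _ 0) => //; lia.
rewrite qweightE // !mulf_neq0 ?invr_eq0 ?mulf_neq0 ?expf_neq0 //.
- apply: qpoch_neq0 => i iN.
  (* The exponents alpha-beta-1 and beta-alpha+2 add up to 1, so a zero factor would mean
     beta-alpha+2 = i+1, which lies in 1..N. *)
  apply: (@neq1_mulr _ _ (q `^ (beta - alpha + 2)) (q ^+ i.+1)); last exact: qd.
  by rewrite -mulrA -pD (_ : _ + _ = 1) ?powRr1 ?ltW -?exprSr //; ring.
- apply: qpoch_neq0 => i iN.
  apply: (@neq1_mulr _ _ (q `^ beta) (q ^+ i)); first by rewrite powRN mulfVK.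
  rewrite eq_sym -[q `^ _]mul1r; apply: (@avoids_expr _ N _ _ 0) => //; lia.
- by rewrite mulf_neq0.
- apply: qpoch_neq0 => i ix.
  apply: (@neq1_mulr _ _ (q ^+ N) (q ^+ i)); first by rewrite mulfVK.
  have -> : N = ((N - i).-1.+1 + i)%N by lia.
  by rewrite exprD eq_sym -[X in _ != X]mul1r (inj_eq (mulIf _)) ?expr_neq1.
- by apply: qpoch_neq0 => i ix; apply: (@qpow_alpha_neq1 _ N) => //; lia.
- by apply: qpoch_neq0 => i _; rewrite -exprSr expr_neq1.
- by apply: qpoch_neq0 => i ix; apply: qpow_shift_neq1 => //; lia.
Qed.

(** Since (phi_k, psi_j) depends on k+j up to powers, the product becomes a constant times a double
    sum symmetric in (n,k) and (m,j). Summing first over the index that belongs to the larger of n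
    and m gives 0. *)
Lemma qU_orthogonal (R : realType) (N : nat) (q alpha beta : R) (n m : 'I_N.+1) :
  0 < q -> q != 1 ->
  avoids N alpha -> avoids N beta -> avoids N (beta - alpha + 2) -> n != m ->
  qdot alpha beta q (fun x : 'I_N.+1 => qU n x%:R alpha beta N q)
    (fun x : 'I_N.+1 => qU m (N%:R - x%:R) (beta - alpha + 2) beta N q^-1) = 0.
Proof.
move=> q_gt0 q_neq1 alphaP betaP beta_alphaP nm.
have q0 : q != 0 by rewrite gt_eqF.
have q1 i : q ^+ i.+1 != 1 by apply: expr_neq1.
have nzq k : q ^+ k != 0 by rewrite expf_neq0.
have [K VE] := @qU_dual_grid _ N m q alpha beta q_gt0.
set b := q `^ beta in VE *; set a := q `^ alpha in VE *.
have b0 : b != 0 by rewrite powR_eq0 negb_and q0.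
have a0 : a != 0 by rewrite powR_eq0 negb_and q0.
set d := b * q ^+ 2 / a / q ^+ N in VE *.
pose g := b * q / q ^+ N.
have ha i : (i < N)%N -> q ^+ i * (q / a) != 1 by exact: qpow_alpha_neq1.
have hd i : (i < N)%N -> q ^+ i * d != 1 by exact: qpow_shift_neq1.
have hg i : (i < N.*2.-1)%N -> q ^+ i * g != 1.
  move=> iN; apply: (@neq1_mulr _ _ (q ^+ N) (q ^+ i.+1 * b)).
    by rewrite /g exprS; field; rewrite nzq.
  by apply: (@avoids_expr _ N) => //; lia.
pose W (x : 'I_N.+1) := (b * q) ^+ x
  * (qpoch (q ^- N) q x * qpoch (q / a) q x / (qpoch q q x * qpoch d q x)).
pose f (k : 'I_n.+1) := ucoef q b N n k * (a / b) ^+ k.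
pose h (j : 'I_m.+1) := ucoef q b N m j * q ^+ j.
pose phi (k : 'I_n.+1) (x : 'I_N.+1) := ubasis q a k x.
pose psi (j : 'I_m.+1) (x : 'I_N.+1) :=
  qpoch (q ^+ x * q ^- N) q j / qpoch (q ^+ x * d) q j.
have [c cE] : exists c,
    qdot alpha beta q (fun x : 'I_N.+1 => qU n x%:R alpha beta N q)
      (fun x : 'I_N.+1 => qU m (N%:R - x%:R) (beta - alpha + 2) beta N q^-1)
  = c * \sum_x W x * (\sum_k f k * phi k x) * (\sum_j h j * psi j x).
  pose c1 := q `^ ((1 - alpha) * N%:R)
    * (qpoch (q `^ (alpha - beta - 1)) q N / qpoch (q `^ (- beta)) q N).
  pose c2 := qpoch (q ^- N) q n / qpoch (q ^- n / b) q n.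
  exists (c1 * c2 * K); rewrite mulr_sumr; apply: eq_bigr => x _.
  rewrite VE; last by rewrite -ltnS.
  rewrite qU_grid // qweightE // -/a -/b -/d -/c1 -/c2 -/(W x).
  move: c1 c2 (W x) (\sum_(k < n.+1) _) (\sum_(j < m.+1) _).
  by move=> *; ring.
pose G s := qpoch (q ^- N) q s / qpoch g q s.
(* The power from [basis_dot] turns (a/b)^k into the q^k that [ucoef_sum_eq0] requires. *)
have fE k : f k * (b * q / a) ^+ k = ucoef q b N n k * q ^+ k.
  rewrite /f -mulrA -exprMn; congr (_ * _ ^+ _).
  by field; rewrite a0 b0.
rewrite cE dot_expand.
rewrite [X in c * X](_ : _ = (qpoch g q N / qpoch d q N) *
  \sum_(k < n.+1) \sum_(j < m.+1)
    ucoef q b N n k * q ^+ k * (ucoef q b N m j * q ^+ j) * G (k + j)%N).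
  have nN := ltn_ord n; have mN := ltn_ord m.
  have [nltm|mltn|/val_inj/eqP] := ltngtP n m; last by rewrite (negPf nm).
    rewrite [X in _ * (_ * X)]big1 ?mulr0 // => k _.
    have kn := ltn_ord k.
    transitivity (ucoef q b N n k * q ^+ k * 0); last by rewrite mulr0.
    rewrite -[X in _ = _ * X](@ucoef_sum_eq0 _ q b N m k q0 q1 hg ltac:(lia) ltac:(lia)) mulr_sumr.
    by apply: eq_bigr => j _; rewrite /G /ucoef addnC; ring.
  rewrite exchange_big /= [X in _ * (_ * X)]big1 ?mulr0 // => j _.
  have jm := ltn_ord j.
  transitivity (ucoef q b N m j * q ^+ j * 0); last by rewrite mulr0.
  rewrite -[X in _ = _ * X](@ucoef_sum_eq0 _ q b N n j q0 q1 hg ltac:(lia) ltac:(lia)) mulr_sumr.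
  by apply: eq_bigr => k _; rewrite /G /ucoef; ring.
rewrite mulr_sumr; apply: eq_bigr => k _; rewrite mulr_sumr; apply: eq_bigr => j _.
rewrite -fE /W /phi /psi /ubasis basis_dot //; last by move=> i iN; apply: hg; lia.
rewrite /h -/d -/g -/(G _).
move: (f k) (ucoef _ _ _ _ _) (_ ^+ k) => *; ring.
Qed.

Theorem proposition5 (R : realType) (N : nat) (q alpha beta : R)
    (N_ge1 : (1 <= N)%N) (q_gt0 : 0 < q) (q_neq1 : q != 1)
    (alphaP : avoids N alpha) (betaP : avoids N beta)
    (beta_alphaP : avoids N (beta - alpha + 2)) :
  let U (n x : 'I_N.+1) : R := qU n x%:R alpha beta N q in
  let V (m x : 'I_N.+1) : R :=
    qU m (N%:R - x%:R) (beta - alpha + 2) beta N q^-1 in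
  biorthogonal_partners (qdot alpha beta q) U V /\
  (forall (m : 'I_N.+1) (g : 'I_N.+1 -> R),
     (forall n : 'I_N.+1, n != m -> qdot alpha beta q (U n) g = 0) <->
     (exists c : R, forall x : 'I_N.+1, g x = c * V m x)).
Proof.
move=> U V; apply: (@biorthogonal_of_unitmx _ N (qdot alpha beta q)
  (fun x => qweight alpha beta N q x) U V) => //.
- by move=> x; apply: qweight_neq0 => //; rewrite -ltnS.
- exact: qU_unitmx.
(* The reflection x -> N-x only permutes columns, so [qU_unitmx] applies with base 1/q and
   beta-alpha+2 in place of alpha. *)
- have -> : (\matrix_(m, x) V m x) = col_perm (perm rev_ord_inj)
      (\matrix_(m < N.+1, x < N.+1) qU m x%:R (beta - alpha + 2) beta N q^-1).
    apply/matrixP => m x; rewrite !mxE permE /V /= subSS natrB //.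
    by rewrite -ltnS.
  rewrite col_permE unitmx_mul unitmx_perm andbT.
  by apply: qU_unitmx; rewrite ?invr_gt0 ?invr_eq1.
- by move=> n m; apply: qU_orthogonal.
Qed.
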